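(* Let $\pi \in \mathfrak{S}_n$ be a permutation different from the identity, and let $Q = Q(\pi)$ be its RSK recording tableau. Then $$\operatorname{ls}_1(\pi) = \max\{ i + j : Q(1, i) + \operatorname{evac}(Q)(1, j) \leq n\},$$ where $i,j$ range over the column indices of the boxes in the first row of $Q$ (which has the same shape as $\operatorname{evac}(Q)$).
   Context: $\mathfrak{S}_n$ is the set of permutations of $[n]=\{1,\dots,n\}$. For $I=\{i_1<\cdots<i_k\}\subseteq[n]$, $\pi_I=\pi(i_1)\cdots\pi(i_k)$; $\operatorname{des}(\sigma)$ is the number of descents of a sequence $\sigma$ (positions $i$ with $\sigma(i)>\sigma(i+1)$). $\operatorname{ls}_1(\pi)=\max\{\#I : I\subseteq[n],\ \operatorname{des}(\pi_I)=1\}$ (equal to $0$ if there is no such $I$). $Q(\pi)$ is the recording tableau of $\pi$ under the Robinson–Schensted correspondence (row insertion of $\pi(1),\dots,\pi(n)$ in order). For a tableau $T$, $T(1,i)$ is the $i$-th entry of its first row. For a standard Young tableau (SYT) $Q$ with $n$ boxes, $\operatorname{evac}(Q)$ is its image under the Schützenberger involution (evacuation), an SYT of the same shape, defined by a growth diagram as follows. Define partitions $\Lambda_{i,j}$, $0\le i\le j\le n$, with $|\Lambda_{i,j}|=j-i$: $\Lambda_{0,j}$ is the shape formed by the boxes of $Q$ with entries at most $j$; $\Lambda_{i,i}=\varnothing$; and for $1\le i<j\le n$, $\Lambda_{i,j}$ satisfies $\Lambda_{i,j-1}\subset\Lambda_{i,j}\subset\Lambda_{i-1,j}$ and is chosen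 different from $\Lambda_{i-1,j-1}$ whenever possible (there are at most two partitions strictly between $\Lambda_{i,j-1}$ and $\Lambda_{i-1,j}$). Then $\operatorname{evac}(Q)$ is the SYT encoded by the chain $\varnothing=\Lambda_{n,n}\subset\Lambda_{n-1,n}\subset\cdots\subset\Lambda_{0,n}$ (the entry $i$ is in the box $\Lambda_{n-i,n}\setminus\Lambda_{n-i+1,n}$). *)

(* Defs.v *)
From mathcomp Require Import all_boot all_fingroup.

Set Implicit Arguments.
Unset Strict Implicit.
Unset Printing Implicit Defensive.

Definition des (s : seq nat) : nat :=
  count (fun i => nth 0 s i.+1 < nth 0 s i) (iota 0 (size s).-1).

(* 'I_n is {0, ..., n-1}, so values are shifted by one to make them range over
   {1, ..., n}.  [enum I] lists I in increasing order. *)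
Definition subword n (pi : 'S_n) (I : {set 'I_n}) : seq nat :=
  [seq (pi i).+1 | i <- enum I].

Definition ls1 n (pi : 'S_n) : nat :=
  \max_(I : {set 'I_n} | des (subword pi I) == 1) #|I|.

(* A tableau is the list of its rows, top row (the longest) first. *)
Definition tableau := seq (seq nat).

(* 1-based: [entry T r c] is T(r, c). *)
Definition entry (T : tableau) (r c : nat) : nat :=
  nth 0 (nth [::] T r.-1) c.-1.

(* When no entry of [row] exceeds x, [find] returns [size row] and [set_nth]
   appends x at the end of the row. *)
Fixpoint row_insert (x : nat) (T : tableau) : tableau :=
  if T is row :: T' then
    let k := find (fun y => x < y) row in
    let row' := set_nth 0 row k x in
    if k < size row then row' :: row_insert (nth 0 row k) T' else row' :: T'
  else [:: [:: x]].

Definition insertion_tableau (w : seq nat) : tableau :=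
  foldl (fun T x => row_insert x T) [::] w.

Definition is_partition (la : seq nat) : bool :=
  sorted geq la && all (fun p => 0 < p) la.

Definition contained (mu la : seq nat) : bool :=
  all (fun r => nth 0 mu r <= nth 0 la r) (iota 0 (size mu)).

(* Index of the first row in which la and mu differ, i.e. the row of the box
   la \ mu when la is obtained from mu by adding one box. *)
Definition new_row (mu la : seq nat) : nat :=
  find (fun r => nth 0 mu r != nth 0 la r) (iota 0 (size la)).

(* The tableau encoded by a chain c 0 = [::], c 1, ..., c n of partitions, each
   obtained from the previous one by adding a box: i is in the box
   c i \ c (i - 1). *)
Definition tableau_of_chain (c : nat -> seq nat) (n : nat) : tableau :=
  foldl (fun T i => let r := new_row (c i.-1) (c i) in
                    set_nth [::] T r (rcons (nth [::] T r) i))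
        [::] (iota 1 n).

Definition recording_tableau (w : seq nat) : tableau :=
  tableau_of_chain (fun k => shape (insertion_tableau (take k w))) (size w).

Definition Qtab n (pi : 'S_n) : tableau := recording_tableau (subword pi setT).

Definition restricted_shape (T : tableau) (j : nat) : seq nat :=
  [seq m <- [seq count (fun x => x <= j) row | row <- T] | 0 < m].

(* The partitions with one box more than mu that lie between mu and nu. *)
Definition between (mu nu : seq nat) : seq (seq nat) :=
  [seq la <- [seq incr_nth mu r | r <- iota 0 (size mu).+1]
     | is_partition la && contained la nu].

(* An element of [between mu nu] different from [old] if there is one (it is
   unique when nu has two boxes more than mu, and [old] is between them), and
   [old] otherwise. *)
Definition local_rule (mu old nu : seq nat) : seq nat :=
  head old [seq la <- between mu nu | la != old].

(* [growth Q i j] is Lambda_{i,j}; it is [::] for j <= i (only i = j matters). *)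
Fixpoint growth (Q : tableau) (i : nat) : nat -> seq nat :=
  if i is i'.+1 then
    fix growth_i (j : nat) : seq nat :=
      if j is j'.+1 then
        if j <= i then [::]
        else local_rule (growth_i j') (growth Q i' j') (growth Q i' j)
      else [::]
  else fun j => restricted_shape Q j.

Definition evac (Q : tableau) : tableau :=
  let n := sumn (shape Q) in
  tableau_of_chain (fun i => growth Q (n - i) n) n.

(* Main.v *)
Require Import Defs.
From mathcomp Require Import all_boot all_fingroup zify.

(** Write lis for the maximal length of an increasing subword.  A word with
    exactly one descent is the concatenation of two nonempty increasing words,
    so ls1 pi compares with the maximum over m of
    lis(pi(1) .. pi(m)) + lis(pi(m+1) .. pi(n)).  Conversely, two increasing
    subwords taken from a prefix and from the complementary suffix concatenate
    to a word with at most one descent; if there is no descent, the subword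
    can be enlarged one letter at a time until a descent appears, because pi is
    not the identity and inserting one letter in an increasing word creates at
    most one descent ([ls1_ge]).

    It remains to read both terms off the tableaux.  By Schensted's theorem
    ([size_increasing_le] and [ex_increasing]) the first row of the shape of
    the insertion tableau of a word w, denoted [sh w], has length lis(w).
    Since the boxes of the first row of Q appear as this length grows along
    the prefixes of pi, Q(1,i) <= m says that i <= lis(pi(1) .. pi(m)).
    Likewise evac(Q)(1,j) <= n - m says that j <= lis(pi(m+1) .. pi(n)),
    provided that Lambda_{i,j} is the shape [sh] of the factor
    pi(i+1) .. pi(j).

    This last fact ([growth_factor]) is the heart of the proof.  It amounts to
    the statement [jdt_wordP]: for a word y w x without repetition, the shapes
    of w, y w, w x and y w x form a square which obeys the local rule of jeu de
    taquin.  It is proved by induction on the size of w, by removing the largest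
    letter v of y w x.  When v lies in w, the shapes of the four words with and
    without v are the vertices of a cube.  Two opposite faces obey the rule of
    jeu de taquin, one for the words without v (the induction hypothesis) and
    one for the words with v (the goal).  The two faces where x is appended
    obey Fomin's rule for row insertion ([row_square_max]): if both edges add
    the same box, the next box is added in the next row.  The two faces where
    y is prepended obey the transposed rule, about columns.  The lemma [cube]
    says that four of these faces determine that the two remaining ones are
    as expected; it only concerns partitions, and it also propagates the
    column rule, which is proved along the way.  When v is x or y, a box is
    added at the end of the first row or of the first column, and the square
    is explicit. *)

Set Implicit Arguments.
Unset Strict Implicit.
Unset Printing Implicit Defensive.

(** * Adding boxes to a partition *)

(** A box that can be added to a partition is given by its row [r] alone; its
    column, counted from 0, is [nth 0 la r]. *)
Definition addable (la : seq nat) r := (r == 0) || (nth 0 la r < nth 0 la r.-1).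

Definition adds la r mu := mu = incr_nth la r /\ addable la r.

Lemma is_partitionP la :
  reflect ((forall r s, r <= s -> nth 0 la s <= nth 0 la r) /\
           forall r, (r < size la) = (0 < nth 0 la r))
          (is_partition la).
Proof.
apply: (iffP andP) => [[sorted_la pos_la]|[le_la pos_la]]; split.
- move=> r s le_rs; case: (ltnP s (size la)) => [lt_s|le_s]; last first.
    by rewrite (nth_default 0 le_s).
  have geq_trans: transitive geq by move=> y x z /= ? ?; lia.
  apply: (sorted_leq_nth geq_trans (leqnn : reflexive geq) 0 sorted_la) => //.
  by rewrite inE; lia.
- move=> r; case: (ltnP r (size la)) => [lt_r|le_r].
    by rewrite (all_nthP 0 pos_la).
  by rewrite nth_default.
- by apply/(sortedP 0) => r _; apply: le_la.
- by apply/(all_nthP 0) => r; rewrite pos_la.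
Qed.

Lemma partition_le la r s :
  is_partition la -> r <= s -> nth 0 la s <= nth 0 la r.
Proof. by case/is_partitionP => + _; apply. Qed.

Lemma partition_incr la r :
  is_partition la -> addable la r -> is_partition (incr_nth la r).
Proof.
move=> part_la add_r; apply/is_partitionP; split=> [i j le_ij|i].
  have := partition_le part_la le_ij; rewrite !nth_incr_nth.
  case: (r =P j) => [eq_rj|ne_rj]; [subst j|by lia].
  have := @partition_le la i r.-1 part_la.
  move: add_r; rewrite /addable; case: (r =P i) => [?|ne_ri]; lia.
move/is_partitionP: (part_la) => [_ pos_la].
rewrite size_incr_nth nth_incr_nth; case: ifP => [lt_r|ge_r].
  by rewrite pos_la; case: eqP => // <-; move: lt_r; rewrite pos_la; lia.
case: (r =P i) => [<-|ne_ri]; first by lia.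
rewrite add0n -pos_la.
move: add_r; rewrite /addable => /orP[/eqP r0|lt_r]; first by lia.
have: r.-1 < size la by rewrite pos_la; lia.
by lia.
Qed.

Lemma addable_of_incr la r :
  is_partition (incr_nth la r) -> addable la r.
Proof.
move=> part_la; rewrite /addable; case: eqP => //= r_neq0.
have := @partition_le _ r.-1 r part_la (leq_pred r).
by rewrite !nth_incr_nth eqxx; case: eqP; lia.
Qed.

Lemma addable_other la r s :
  addable la r -> r != s -> addable (incr_nth la s) r.
Proof. by rewrite /addable !nth_incr_nth; lia. Qed.

(** Rows [r < s] of equal length leave no room for a box at the end of row
    [s]. *)
Lemma addable_col_inj la r s : is_partition la ->
  addable la r -> addable la s -> nth 0 la r = nth 0 la s -> r = s.
Proof.
move=> part_la; wlog le_rs: r s / r <= s => [th_rs add_r add_s eq_rs|].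
  by case: (leqP r s) => [|/ltnW] /th_rs => [|th_sr]; [|apply/esym]; auto.
rewrite /addable => _ add_s eq_rs; have := @partition_le la r s.-1 part_la.
by move: add_s; lia.
Qed.

Lemma adds_inj la r s mu : adds la r mu -> adds la s mu -> r = s.
Proof. by case=> -> _ [/incr_nth_inj]. Qed.

(** * Local rules on squares of partitions *)

(** Fomin's rule for row insertion: when the edges that leave a corner of a
    square add boxes in rows [b] and [c], the edge parallel to [b] adds a box
    in row [row_next b c]. *)
Definition row_next b c := if b == c then b.+1 else b.

(** When [b = c], the box just added in row [c] makes room below for a box in
    row [c.+1]. *)
Lemma row_next_addable la b c : is_partition la ->
  addable la b -> addable la c -> addable (incr_nth la c) (row_next b c).
Proof.
move=> part_la add_b add_c; rewrite /row_next.
case: eqP => [->|/eqP]; last first.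
  exact: addable_other.
rewrite /addable !nth_incr_nth.
have := partition_le part_la (leqnSn c) => /=; lia.
Qed.

(** The edges [a'] and [b'] are parallel to [a] and [b].  If [a = b], the two
    boxes of the skew shape are added in a forced order: they are adjacent,
    either in the same row or, when the rows [a] and [a.+1] of [la] have the
    same length, in the same column. *)
Definition jdt_rule la a b a' b' :=
  if a == b then
    a' = b' /\ (a' = a \/ a' = a.+1 /\ nth 0 la a.+1 = nth 0 la a)
  else a' = a /\ b' = b.

(** The transpose of Fomin's rule: if both edges add the same box, the next
    box is added at the end of the next column. *)
Definition col_rule la a c a' c' :=
  if a == c then a' = c' /\ nth 0 (incr_nth la a) a' = (nth 0 la a).+1
  else a' = a /\ c' = c.

Definition jdt_square la A B AB :=
  exists a b a' b', [/\ adds la a A, adds la b B, adds B a' AB, adds A b' AB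
                      & jdt_rule la a b a' b'].

Definition row_square la B C BC :=
  exists b c, [/\ adds la b B, adds la c C, adds C (row_next b c) BC
                & adds B (row_next c b) BC].

Definition col_square la A C AC :=
  exists a c a' c', [/\ adds la a A, adds la c C, adds C a' AC, adds A c' AC
                      & col_rule la a c a' c'].

(** The edges of the cube that start at [la] are [a], [b] and [c]; the vertex
    [AB] is reached by adding the boxes of [a] and [b], and so on.  The cases
    are the coincidences between [a], [b] and [c].  A box of the last edge
    [a3] is then exhibited: it is [a] if the three boxes do not interact, and
    otherwise the box that the two rules push further. *)
Lemma cube la A B C AB AC BC ABC : is_partition la ->
    jdt_square la A B AB -> col_square la A C AC ->
    row_square la B C BC -> row_square A AB AC ABC ->
  jdt_square C AC BC ABC /\ col_square B AB BC ABC.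
Proof.
move=> part_la [a [b [a1 [b1 [Aa Bb ABa ABb jdt_la]]]]].
move=> [a' [c [a2 [c1 [Aa' Cc ACa ACc col_la]]]]].
have ? := adds_inj Aa' Aa; subst a'.
move=> [b' [c' [Bb' Cc' BCb BCc]]].
have ? := adds_inj Bb' Bb; subst b'.
have ? := adds_inj Cc' Cc; subst c'. clear Bb' Cc'.
move=> [b' [c' [Bb' Cc' ABCb ABCc]]].
have ? := adds_inj Bb' ABb; subst b'.
have ? := adds_inj Cc' ACc; subst c'.
have [defA add_a] := Aa; have [defB add_b] := Bb; have [defC add_c] := Cc.
have [defBC _] := BCc; have [defABC _] := ABCc.
have [defAB' _] := ABb; have [defAB add_a1] := ABa; have [defAC add_a2] := ACa.
have [defAC' add_c1] := ACc; have [_ add_b1] := ABb.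
suff [a3 [jdtC colB add_a3 eq_ABC]]: exists a3,
  [/\ jdt_rule C a2 (row_next b c) a3 (row_next b1 c1),
      col_rule B a1 (row_next c b) a3 (row_next c1 b1),
      addable BC a3 & ABC = incr_nth BC a3].
  by split; [exists a2, (row_next b c), a3, (row_next b1 c1)
            |exists a1, (row_next c b), a3, (row_next c1 b1)].
rewrite defABC defAB defBC; move: jdt_la col_la.
rewrite /jdt_rule /col_rule.
case: (a =P b) => [?|/eqP ne_ab]; [subst b|];
  case: (a =P c) => [?|/eqP ne_ac]; try subst c.
- move=> [? cases] [? eq_col]; subst b1 c1.
  rewrite /row_next eqxx; case: cases => [?|[? eq_la]]; subst a1.
    have ? : a2 = a.
      apply: (@addable_col_inj A) => //; rewrite defA.
        exact: partition_incr.
      by rewrite eq_col nth_incr_nth eqxx.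
    subst a2; rewrite eqxx.
    exists a; rewrite defB; split=> //.
    - by case: eqP => //; lia.
    - by case: eqP => //; lia.
    - by apply: addable_other; [rewrite -defB | lia].
    by rewrite (incr_nthC _ a.+1).
  have ne_a2 : a2 != a.+1.
    apply/eqP=> eq_a2; move: eq_col; rewrite eq_a2 nth_incr_nth.
    by case: eqP; lia.
  exists a2; rewrite eqxx (eq_sym a.+1) (negPf ne_a2) defB; split=> //.
    split=> //; rewrite !nth_incr_nth.
    by move: eq_col; rewrite nth_incr_nth; lia.
  by apply: addable_other; rewrite // -defC.
- move=> [? cases] [? ?]; subst b1 a2 c1.
  have ne_a1 : a1 != c.
    case: cases => [->|[-> eq_la]] //.
    by apply/eqP=> eq_c; move: add_c; rewrite /addable -eq_c /=; lia.
  rewrite /row_next (eq_sym c) (negPf ne_ac) (eq_sym c) (negPf ne_a1) eqxx.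
  exists a1; split=> //.
  - split=> //; case: cases => [|[eq_a1 eq_la]]; [by left|right].
    split=> //; rewrite defC !nth_incr_nth.
    by move: ne_a1; rewrite eq_a1; lia.
  - by apply: addable_other; rewrite // -?defB.
  by rewrite (incr_nthC _ c).
- move=> [? ?] [? eq_col]; subst a1 b1 c1.
  rewrite /row_next (eq_sym b) (negPf ne_ab) eqxx.
  case: (a2 =P b) => [?|/eqP ne_a2].
    subst a2; rewrite eqxx.
    (* Here b is the box of the column to the right of a, so it lies above a
       and the rows strictly between them have the length of row b. *)
    have eq_b: nth 0 la b = (nth 0 la a).+1.
      by move: eq_col; rewrite nth_incr_nth; lia.
    have lt_ba: b < a.
      by have := @partition_le la a b part_la; lia.
    have eq_bS : nth 0 C b.+1 = nth 0 la b.
      rewrite defC nth_incr_nth; case: eqP => [<-|ne_aS]; first by lia.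
      have := @partition_le la b.+1 a.-1 part_la.
      have := partition_le part_la (leqnSn b).
      by move: add_a; rewrite /addable; lia.
    exists b.+1; split=> //.
    - split=> //; right; split=> //.
      by rewrite eq_bS defC nth_incr_nth (negPf ne_ab).
    - split=> //; rewrite defB !nth_incr_nth.
      by move: eq_bS; rewrite defC nth_incr_nth; lia.
    - rewrite defB (incr_nthC la) -defC /addable /= !nth_incr_nth eqxx eq_bS.
      by rewrite defC nth_incr_nth (negPf ne_ab); lia.
  rewrite eq_sym (negPf ne_a2); exists a2; split=> //.
  + split=> //; rewrite defB !nth_incr_nth.
    by move: eq_col; rewrite nth_incr_nth; case: eqP; lia.
  rewrite defB (incr_nthC la) -defC.
  by apply: addable_other.
move=> [? ?] [? ?]; subst a1 b1 a2 c1.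
rewrite /row_next (eq_sym c); case: (b =P c) => [?|/eqP ne_bc].
  subst c; case: (a =P b.+1) => [?|/eqP ne_a].
    subst a; exists b.+1; split=> //.
    - by split=> //; left.
    - by split=> //; rewrite defB !nth_incr_nth eqxx; lia.
    - rewrite defB /addable !nth_incr_nth /= !eqxx.
      by move: add_a; rewrite /addable /=; lia.
  exists a; split=> //; last by rewrite (incr_nthC _ b.+1).
  by do 2!apply: addable_other => //.
exists a; rewrite (negPf ne_ab) (negPf ne_ac); split=> //.
  rewrite defB; do 2!apply: addable_other => //.
by rewrite (incr_nthC _ c).
Qed.

(** * Shapes of insertion tableaux *)

Fixpoint new_box_row x (T : tableau) :=
  if T is row :: T' then
    let k := find (fun y => x < y) row in
    if k < size row then (new_box_row (nth 0 row k) T').+1 else 0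
  else 0.

Definition sh w := shape (insertion_tableau w).

Definition bounded v (T : tableau) := all (all (fun y => y < v)) T.

Definition add_entry v c (T : tableau) : tableau :=
  set_nth [::] T c (rcons (nth [::] T c) v).

Lemma shape_add_entry v c T : shape (add_entry v c T) = incr_nth (shape T) c.
Proof.
rewrite /add_entry; elim: T c => [|row T IHT] c.
  rewrite set_nth_nil nth_nil.
  have -> : incr_nth (shape [::]) c = ncons c 0 [:: 1] by case: c.
  by elim: c => //= c ->.
by case: c => [|c] /=; [rewrite size_rcons | rewrite IHT].
Qed.

Lemma shape_row_insert x T :
  shape (row_insert x T) = incr_nth (shape T) (new_box_row x T).
Proof.
elim: T x => [|row T IHT] x //=; case: ifP => lt_k /=.
  by rewrite size_set_nth IHT; congr (_ :: _); apply/maxn_idPr.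
rewrite size_set_nth; congr (_ :: _).
have := find_size (fun y => x < y) row; lia.
Qed.

Lemma insertion_tableau_rcons w x :
  insertion_tableau (rcons w x) = row_insert x (insertion_tableau w).
Proof. exact: foldl_rcons. Qed.

Lemma bounded_row_insert v x T :
  x < v -> bounded v T -> bounded v (row_insert x T).
Proof.
move=> + bT; elim: T bT x => [|row T IHT] /=; first by move=> _ x ->.
move=> /andP[b_row bT] x lt_xv.
have b_row': all (fun y => y < v) (set_nth 0 row (find (fun y => x < y) row) x).
  apply/(all_nthP 0) => i _; rewrite nth_set_nth /=; case: eqP => // _.
  case: (ltnP i (size row)) => [lt_i|le_i]; first exact: (all_nthP 0 b_row).
  by rewrite nth_default //; lia.
case: ifP => lt_k /=; rewrite b_row' //=.
by apply: IHT => //; apply: (all_nthP 0 b_row).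
Qed.

Lemma bounded_insertion v w :
  all (fun y => y < v) w -> bounded v (insertion_tableau w).
Proof.
elim/last_ind: w => // w x IHw; rewrite all_rcons insertion_tableau_rcons.
by case/andP=> lt_xv /IHw; apply: bounded_row_insert.
Qed.

Lemma find_none x (row : seq nat) :
  all (fun y => y < x) row -> find (fun y => x < y) row = size row.
Proof.
by move=> b_row; apply/hasNfind/hasPn => y /(allP b_row); lia.
Qed.

Lemma row_insert_max v T :
  bounded v T -> row_insert v T = add_entry v 0 T /\ new_box_row v T = 0.
Proof.
case: T => //= row T /andP[b_row _]; rewrite find_none // ltnn; split=> //.
by rewrite /add_entry /= set_nthE ltnn subnn cats1.
Qed.

Lemma set_nth_rcons_lt (s : seq nat) k x y :
  k < size s -> set_nth 0 (rcons s y) k x = rcons (set_nth 0 s k x) y.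
Proof. by elim: s k => [|z s IHs] [|k] //= lt_k; rewrite IHs. Qed.

Lemma set_nth_rcons_last (s : seq nat) x y :
  set_nth 0 (rcons s y) (size s) x = rcons s x.
Proof. by elim: s => //= z s ->. Qed.

Lemma set_nth_size (s : seq nat) x : set_nth 0 s (size s) x = rcons s x.
Proof. by rewrite set_nthE ltnn subnn cats1. Qed.

(** Fomin's rule on tableaux.  A largest entry [v], at the end of row [c], does
    not interfere with the insertion of [x] unless this insertion ends in row
    [c]: then [x] takes the place of [v], which is bumped to the end of the
    next row. *)
Lemma row_insert_add_entry v c x T : bounded v T -> x < v ->
  let b := new_box_row x T in
  row_insert x (add_entry v c T) = add_entry v (row_next c b) (row_insert x T)
  /\ new_box_row x (add_entry v c T) = row_next b c.
Proof.
elim: T x c => [|row T IHT] x c /=.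
  case: c => [|c] _ lt_xv; rewrite /add_entry /row_next /= ?lt_xv //.
  by rewrite nth_nil set_nth_nil.
case/andP=> b_row bT lt_xv; rewrite /row_next.
set k := find _ row; have le_k : k <= size row := find_size _ _.
case: c => [|c].
  have -> : add_entry v 0 (row :: T) = rcons row v :: T by [].
  rewrite /=; have -> : find (fun y => x < y) (rcons row v) = k.
    by rewrite -cats1 find_cat /= lt_xv addn0 /k; case: ifPn => // /hasNfind ->.
  rewrite size_rcons ltnS le_k nth_rcons.
  case: (ltnP k (size row)) => [lt_k|ge_k] /=.
    by rewrite set_nth_rcons_lt.
  have -> : k = size row by lia.
  rewrite eqxx; have [-> ->] := row_insert_max bT; split=> //.
  by rewrite set_nth_rcons_last set_nth_size.
have -> : add_entry v c.+1 (row :: T) = row :: add_entry v c T by [].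
rewrite /= -/k; case: (ltnP k (size row)) => [lt_k|ge_k] //=.
  have [|-> ->] := IHT (nth 0 row k) c bT; first exact: (all_nthP 0 b_row).
  by rewrite /row_next !eqSS; split=> //; case: eqP.
Qed.

Lemma sh_rcons w x :
  sh (rcons w x) = incr_nth (sh w) (new_box_row x (insertion_tableau w)).
Proof. by rewrite /sh insertion_tableau_rcons shape_row_insert. Qed.

(** For [v] larger than the letters of [w1] and [w2], [c] is the row of [v] in
    the insertion tableau of [w1 ++ v :: w2]. *)
Definition max_entry_row w1 v w2 c :=
  insertion_tableau (w1 ++ v :: w2) =
  add_entry v c (insertion_tableau (w1 ++ w2)).

Lemma max_entry_row_shape w1 v w2 c :
  max_entry_row w1 v w2 c -> sh (w1 ++ v :: w2) = incr_nth (sh (w1 ++ w2)) c.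
Proof. by rewrite /sh => ->; rewrite shape_add_entry. Qed.

Lemma max_entry_row_nil w1 v :
  all (fun y => y < v) w1 -> max_entry_row w1 v [::] 0.
Proof.
move=> /bounded_insertion b_w1; rewrite /max_entry_row cats0 cats1.
by rewrite insertion_tableau_rcons; case: (row_insert_max b_w1).
Qed.

Lemma max_entry_row_rcons w1 v w2 x c :
    all (fun y => y < v) (w1 ++ w2) -> x < v -> max_entry_row w1 v w2 c ->
  let b := new_box_row x (insertion_tableau (w1 ++ w2)) in
  max_entry_row w1 v (rcons w2 x) (row_next c b) /\
  new_box_row x (insertion_tableau (w1 ++ v :: w2)) = row_next b c.
Proof.
move=> /bounded_insertion b_w lt_xv def_c b; rewrite /max_entry_row.
rewrite -!rcons_cons -!rcons_cat !insertion_tableau_rcons def_c.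
exact: row_insert_add_entry.
Qed.

Lemma ex_max_entry_row w1 v w2 :
  all (fun y => y < v) (w1 ++ w2) -> exists c, max_entry_row w1 v w2 c.
Proof.
elim/last_ind: w2 => [|w2 x IHw2]; last rewrite -rcons_cat all_rcons.
  by rewrite cats0 => b_w1; exists 0; apply: max_entry_row_nil.
case/andP=> lt_xv b_w; have [c def_c] := IHw2 b_w.
by have [] := max_entry_row_rcons b_w lt_xv def_c; eexists; eassumption.
Qed.

Lemma max_split (w : seq nat) : uniq w -> 0 < size w ->
  exists (w1 : seq nat) (v : nat) (w2 : seq nat),
    w = w1 ++ v :: w2 /\ all (fun y => y < v) (w1 ++ w2).
Proof.
move=> uniq_w; case: w uniq_w => // x w uniq_w _.
pose v := \max_(y <- x :: w) y.
have le_v y : y \in x :: w -> y <= v by move=> y_w; apply: (leq_bigmax_seq y).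
have v_w : v \in x :: w.
  rewrite /v; elim: (w) (x) => [|z s IHs] t; rewrite big_cons ?big_nil ?maxn0.
    exact: mem_head.
  by case: leqP => _; [rewrite in_cons IHs orbT | rewrite mem_head].
case/splitPr: v_w uniq_w le_v => w1 w2 uniq_w le_v.
exists w1, v, w2; split=> //; apply/allP => y y_w.
have: y \in w1 ++ v :: w2.
  by move: y_w; rewrite !mem_cat in_cons; case/orP => ->; rewrite ?orbT.
move/le_v; rewrite leq_eqVlt => /orP[/eqP eq_y|//].
by move: uniq_w; rewrite -cat1s uniq_catCA /= -eq_y y_w.
Qed.

Lemma uniq_drop_mid (w1 : seq nat) v w2 :
  uniq (w1 ++ v :: w2) -> uniq (w1 ++ w2).
Proof. by rewrite -cat1s uniq_catCA /= => /andP[]. Qed.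

(** Removing the largest letter gives an induction on shapes alone: the new box
    is addable because Fomin's rule preserves addability. *)
Lemma sh_partition (w : seq nat) : uniq w -> is_partition (sh w).
Proof.
have [n] := ubnP (size w); elim: n w => // n IHn w le_wn uniq_w.
have [|w_gt0] := posnP (size w); first by move/size0nil ->.
have [w1 [v [w2 [def_w max_v]]]] := max_split uniq_w w_gt0; subst w.
move: le_wn; rewrite size_cat /= => le_wn.
case/lastP: w2 => [|w2 x] in uniq_w max_v w_gt0 le_wn *.
  rewrite cats0 in max_v.
  rewrite (max_entry_row_shape (max_entry_row_nil max_v)) cats0.
  apply: partition_incr => //; apply: IHn; first by lia.
  by have := uniq_drop_mid uniq_w; rewrite cats0.
rewrite size_rcons in le_wn; rewrite -rcons_cat all_rcons in max_v.
case/andP: max_v => lt_xv max_v; have [c def_c] := ex_max_entry_row max_v.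
have uniq_wx := uniq_drop_mid uniq_w.
have uniq_vw : uniq (w1 ++ v :: w2).
  by move: uniq_w; rewrite -rcons_cons -rcons_cat rcons_uniq => /andP[].
have partO : is_partition (sh (w1 ++ w2)).
  by apply: IHn; [rewrite size_cat; lia | apply: uniq_drop_mid uniq_vw].
have partB : is_partition (sh (w1 ++ rcons w2 x)).
  by apply: IHn; rewrite // size_cat size_rcons; lia.
have partC : is_partition (sh (w1 ++ v :: w2)).
  by apply: IHn; rewrite // size_cat /=; lia.
have [_ def_b] := max_entry_row_rcons max_v lt_xv def_c.
rewrite -rcons_cons -rcons_cat sh_rcons def_b.
apply: partition_incr => //; rewrite (max_entry_row_shape def_c).
apply: row_next_addable => //; apply: addable_of_incr.
  by rewrite -sh_rcons rcons_cat.
by rewrite -(max_entry_row_shape def_c).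
Qed.

Lemma adds_rcons (w : seq nat) (x : nat) : uniq (rcons w x) ->
  adds (sh w) (new_box_row x (insertion_tableau w)) (sh (rcons w x)).
Proof.
move=> uniq_wx; split; first exact: sh_rcons.
by apply: addable_of_incr; rewrite -sh_rcons sh_partition.
Qed.

Lemma adds_max_entry (w1 : seq nat) (v : nat) (w2 : seq nat) c :
    uniq (w1 ++ v :: w2) ->
  max_entry_row w1 v w2 c -> adds (sh (w1 ++ w2)) c (sh (w1 ++ v :: w2)).
Proof.
move=> uniq_w def_c; split; first exact: max_entry_row_shape.
by apply: addable_of_incr; rewrite -(max_entry_row_shape def_c) sh_partition.
Qed.

(** One direction of the square appends [x], the other one inserts the largest
    letter [v]. *)
Lemma row_square_max (w1 : seq nat) (v : nat) (w2 : seq nat) (x : nat) :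
    uniq (w1 ++ v :: rcons w2 x) ->
    all (fun y => y < v) (w1 ++ rcons w2 x) ->
  row_square (sh (w1 ++ w2)) (sh (w1 ++ rcons w2 x))
             (sh (w1 ++ v :: w2)) (sh (w1 ++ v :: rcons w2 x)).
Proof.
move=> uniq_w; rewrite -{1}rcons_cat all_rcons => /andP[lt_xv max_v].
have [c def_c] := ex_max_entry_row max_v.
have [def_c' def_b] := max_entry_row_rcons max_v lt_xv def_c.
exists (new_box_row x (insertion_tableau (w1 ++ w2))), c.
have uniq_w2 : uniq (w1 ++ v :: w2).
  by move: uniq_w; rewrite -rcons_cons -rcons_cat rcons_uniq => /andP[].
split.
- rewrite -rcons_cat; apply: adds_rcons.
  by rewrite rcons_cat; apply: uniq_drop_mid uniq_w.
- exact: adds_max_entry.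
- rewrite -def_b -rcons_cons -rcons_cat; apply: adds_rcons.
  by rewrite rcons_cat rcons_cons.
exact: adds_max_entry.
Qed.

(** * Removing the first letter *)

(** By Fomin's rule, a largest letter at the front of a word is bumped each time
    an insertion ends in its row, so that it stays in the first column. *)
Lemma max_entry_front (v : nat) (w : seq nat) :
    uniq (v :: w) -> all (fun y => y < v) w ->
  exists c, adds (sh w) c (sh (v :: w)) /\ nth 0 (sh w) c = 0.
Proof.
elim/last_ind: w => [|w x IHw] uniq_w max_v.
  exists 0; split=> //; apply: (@adds_max_entry [::] v [::]) => //.
have := @row_square_max [::] v w x uniq_w max_v.
move: max_v; rewrite all_rcons => /andP[_ max_v].
have uniq_vw : uniq (v :: w).
  by move: uniq_w; rewrite -rcons_cons rcons_uniq => /andP[].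
have [c [adds_c col_c]] := IHw uniq_vw max_v.
move=> [b [c' [adds_b adds_c' _ adds_cb]]].
have ? := adds_inj adds_c' adds_c; subst c'.
exists (row_next c b); split=> //.
have [-> _] := adds_b; rewrite nth_incr_nth /row_next.
have := partition_le (sh_partition (proj2 (andP uniq_vw))) (leqnSn c).
by case: (c =P b) => [<-|] /=; lia.
Qed.

Definition jdt_word w y x :=
  jdt_square (sh w) (sh (y :: w)) (sh (rcons w x)) (sh (y :: rcons w x)).

(** A largest letter [x] is appended to the first row, before and after
    prepending [y]. *)
Lemma append_max_edges (w : seq nat) (y x : nat) : uniq (y :: rcons w x) ->
    all (fun z => z < x) (y :: w) -> (exists a, adds (sh w) a (sh (y :: w))) ->
  exists a, [/\ adds (sh w) a (sh (y :: w)), adds (sh w) 0 (sh (rcons w x)),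
    adds (sh (rcons w x)) a (sh (y :: rcons w x))
    & adds (sh (y :: w)) 0 (sh (y :: rcons w x))].
Proof.
move=> uniq_w max_x [a adds_a]; have [_ max_w] := andP max_x.
have adds_b : adds (sh w) 0 (sh (rcons w x)).
  have [_ <-] := row_insert_max (bounded_insertion max_w); apply: adds_rcons.
  by case/andP: uniq_w.
have adds_b' : adds (sh (y :: w)) 0 (sh (y :: rcons w x)).
  have [_ <-] := row_insert_max (bounded_insertion max_x).
  exact: (@adds_rcons (y :: w)).
exists a; split=> //; case: adds_a adds_b adds_b' => -> add_a [-> _] [-> _].
split; first by rewrite incr_nthC.
by have [->|a_neq0] := eqVneq a 0; [|apply: addable_other].
Qed.

Lemma jdt_word_row_max (w : seq nat) (y x : nat) : uniq (y :: rcons w x) ->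
  all (fun z => z < x) (y :: w) -> (exists a, adds (sh w) a (sh (y :: w))) ->
  jdt_word w y x.
Proof.
move=> uniq_w max_x ex_a.
have [a [? ? ? ?]] := append_max_edges uniq_w max_x ex_a.
exists a, 0, a, 0; split=> //.
by rewrite /jdt_rule; case: eqP => [->|]; split=> //; left.
Qed.

(** By [max_entry_front], [y] adds a box in the first column.  If [x] adds the
    same box, [y] is bumped just below it. *)
Lemma jdt_word_col_max (w : seq nat) (y x : nat) : uniq (y :: rcons w x) ->
  all (fun z => z < y) (rcons w x) -> jdt_word w y x.
Proof.
move=> uniq_w max_y; have := @row_square_max [::] y w x uniq_w max_y.
have uniq_yw : uniq (y :: w).
  by move: uniq_w; rewrite -rcons_cons rcons_uniq => /andP[].
have max_yw : all (fun z => z < y) w.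
  by move: max_y; rewrite all_rcons => /andP[].
have [a [adds_a col_a]] := max_entry_front uniq_yw max_yw.
move=> [b [a' [adds_b adds_a' adds_ab adds_ba]]].
have ? := adds_inj adds_a' adds_a; subst a'.
exists a, b, (row_next a b), (row_next b a); split=> //.
rewrite /jdt_rule /row_next (eq_sym b); case: eqP => [<-|] //.
split=> //; right; split=> //.
have := partition_le (sh_partition (proj2 (andP uniq_yw))) (leqnSn a).
by lia.
Qed.

Definition col_word w1 v w2 y :=
  col_square (sh (w1 ++ w2)) (sh (y :: w1 ++ w2))
             (sh (w1 ++ v :: w2)) (sh (y :: w1 ++ v :: w2)).

Lemma col_word_nil (w1 : seq nat) (v y : nat) : uniq (y :: w1 ++ [:: v]) ->
    all (fun z => z < v) (y :: w1) ->
    (exists a, adds (sh w1) a (sh (y :: w1))) ->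
  col_word w1 v [::] y.
Proof.
move=> uniq_w max_v ex_a; rewrite /col_word cats0 cats1.
rewrite cats1 in uniq_w.
have [a [? ? ? ?]] := append_max_edges uniq_w max_v ex_a.
exists a, 0, a, 0; split=> //; rewrite /col_rule.
by case: eqP => [->|//]; split=> //; rewrite nth_incr_nth.
Qed.

(** Induction on the size of [w].  The column rule [col], for the words where
    the largest letter [v] is inserted in [w1 ++ w2], follows by induction on
    [w2] from the cube lemma and from the induction hypothesis for words
    shorter than [w].  A second use of the cube lemma then gives the square
    for [w] itself. *)
Lemma jdt_wordP (w : seq nat) (y x : nat) :
  uniq (y :: rcons w x) -> jdt_word w y x.
Proof.
have [n] := ubnP (size w); elim: n w y x => // n IHn w y x le_wn uniq_w.
have front_edge (u : seq nat) (z : nat) : size u <= size w -> uniq (z :: u) ->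
    exists a, adds (sh u) a (sh (z :: u)).
  case/lastP: u => [|u t] le_u uniq_u; first by exists 0.
  have [|_ [_ [a [_ [_ _ ? _ _]]]]] := IHn u z t _ uniq_u; last by exists a.
  by move: le_u; rewrite size_rcons; lia.
have col (w1 : seq nat) (v : nat) (w2 : seq nat) :
    size (w1 ++ v :: w2) <= size w -> uniq (y :: w1 ++ v :: w2) ->
    all (fun z => z < v) (y :: w1 ++ w2) -> col_word w1 v w2 y.
  elim/last_ind: w2 => [|w2 t IHw2] le_w uniq_v max_v.
    apply: col_word_nil => //; first by rewrite cats0 in max_v.
    apply: front_edge; first by move: le_w; rewrite size_cat; lia.
    by move: uniq_v; rewrite -cat_cons => /uniq_drop_mid; rewrite cats0.
  have [lt_tv max_w] : t < v /\ all (fun z => z < v) (y :: w1 ++ w2).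
    by move: max_v; rewrite /= -rcons_cat all_rcons => /and3P[-> -> ->].
  have uniq_v' : uniq (y :: w1 ++ v :: w2).
    move: uniq_v; rewrite -rcons_cons -rcons_cat -rcons_cons rcons_uniq.
    by case/andP.
  have uniq_t : uniq (y :: w1 ++ rcons w2 t).
    by apply: (@uniq_drop_mid (y :: w1)) uniq_v.
  rewrite size_cat /= size_rcons in le_w.
  apply: (proj2 (@cube (sh (w1 ++ w2)) (sh (y :: w1 ++ w2))
    (sh (w1 ++ rcons w2 t)) _ (sh (y :: w1 ++ rcons w2 t)) _ _ _ _ _ _ _ _)).
  - by apply: sh_partition; have /andP[_ /uniq_drop_mid] := uniq_v'.
  - rewrite -rcons_cat; apply: IHn; first by rewrite size_cat; lia.
    by rewrite rcons_cat.
  - by apply: IHw2; rewrite // size_cat /=; lia.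
  - by apply: row_square_max; [case/andP: uniq_v | case/andP: max_v].
  exact: (@row_square_max (y :: w1)).
(* The largest letter v is y, x or a letter of w. *)
have := @max_split (y :: rcons w x) uniq_w isT.
case=> [[|y' w1]] [v [w2 [/= [? eq_w] max_v]]]; subst.
  exact: jdt_word_col_max.
case/lastP: w2 => [|w2 t] in eq_w max_v *.
  move: eq_w; rewrite cats1 => /rcons_inj[? ?]; subst.
  rewrite cats0 in max_v; apply: jdt_word_row_max => //.
  apply: front_edge => //; move: uniq_w.
  by rewrite -rcons_cons rcons_uniq => /andP[].
move: eq_w; rewrite -rcons_cons -rcons_cat => /rcons_inj[? ?]; subst.
have uniq_v : uniq (y' :: w1 ++ v :: w2).
  by move: uniq_w; rewrite -rcons_cons rcons_uniq => /andP[].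
have max_w : all (fun z => z < v) (y' :: w1 ++ w2).
  by move: max_v; rewrite /= -rcons_cat all_rcons => /and3P[-> _ ->].
have uniq_t : uniq (y' :: w1 ++ rcons w2 t).
  by apply: (@uniq_drop_mid (y' :: w1) v); move: uniq_w; rewrite rcons_cat.
rewrite /jdt_word rcons_cat.
rewrite size_cat /= in le_wn.
apply: (proj1 (@cube (sh (w1 ++ w2)) (sh (y' :: w1 ++ w2))
    (sh (w1 ++ rcons w2 t)) _ (sh (y' :: w1 ++ rcons w2 t)) _ _ _ _ _ _ _ _)).
- by apply: sh_partition; have /andP[_ /uniq_drop_mid] := uniq_v.
- rewrite -rcons_cat; apply: IHn; first by rewrite size_cat; lia.
  by rewrite rcons_cat.
- exact: col.
- rewrite rcons_cat in uniq_w.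
  by apply: row_square_max; [case/andP: uniq_w | case/andP: max_v].
by apply: (@row_square_max (y' :: w1)) => //; move: uniq_w; rewrite rcons_cat.
Qed.

Lemma adds_cons (y : nat) (w : seq nat) : uniq (y :: w) ->
  exists a, adds (sh w) a (sh (y :: w)).
Proof.
case/lastP: w => [|w x] uniq_w; first by exists 0.
by have [_ [_ [a [_ [_ _ ? _ _]]]]] := jdt_wordP uniq_w; exists a.
Qed.

(** * Growth diagrams *)

(** If [A] and [B] differ, the partitions between [O] and [AB] are [A] and [B].
    If they are equal, [jdt_rule] says that the two added boxes are adjacent,
    so that there is no other partition between [O] and [AB]. *)
Lemma local_rule_jdt O A B AB : is_partition O ->
  jdt_square O A B AB -> local_rule O A AB = B.
Proof.
move=> partO [a [b [a' [b' [[defA add_a] [defB add_b] + + rule]]]]].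
move=> [defAB add_a'] [defAB' add_b'].
have in_between la : la \in between O AB ->
    exists2 r, la = incr_nth O r & addable O r /\ (r = a \/ r = b').
  rewrite mem_filter => /andP[/andP[part_la sub_la] /mapP[r _ def_la]].
  exists r => //; subst la; split; first exact: addable_of_incr part_la.
  have r_lt : r \in iota 0 (size (incr_nth O r)).
    by rewrite mem_iota size_incr_nth; case: ifP; lia.
  have := allP sub_la r r_lt; rewrite defAB' defA !nth_incr_nth eqxx.
  have [->|ne_ar] := eqVneq a r; first by left.
  by have [->|] := eqVneq b' r; [right | lia].
rewrite /local_rule; set s := [seq la <- _ | _].
have [eq_AB|ne_AB] := eqVneq A B.
  suff -> : s = [::] by [].
  have eq_ab : a = b by apply: (@incr_nth_inj O); rewrite -defA -defB.
  move: rule; rewrite /jdt_rule eq_ab eqxx => -[eq_a'b' rule].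
  apply/eqP; rewrite -[_ == _]negbK -has_filter; apply/hasPn => la.
  case/in_between => r -> [add_r cases]; rewrite negbK defA.
  case: cases => [-> //|eq_r]; apply/eqP; congr incr_nth.
  case: rule => [|[eq_a' eq_O]]; first by lia.
  move: add_r; rewrite eq_r -eq_a'b' eq_a' /addable /= eq_O; lia.
have ne_ab : a != b.
  by apply: contraNneq ne_AB => eq_ab; rewrite defA defB eq_ab.
have [eq_a' eq_b'] : a' = a /\ b' = b.
  by move: rule; rewrite /jdt_rule (negPf ne_ab).
have B_s : B \in s.
  rewrite mem_filter eq_sym ne_AB andTb mem_filter; apply/andP; split.
    rewrite defB partition_incr //=; apply/allP => r _.
    by rewrite defAB defB !nth_incr_nth leq_addl.
  apply/mapP; exists b => //; rewrite mem_iota add0n ltnS.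
  have /is_partitionP[_ pos_O] := partO.
  move: add_b; rewrite /addable; case: b {defB ne_ab eq_b' rule} => //= b lt_b.
  by rewrite pos_O; lia.
have all_s la : la \in s -> la = B.
  rewrite mem_filter => /andP[ne_la /in_between[r def_la [_ [eq_r|eq_r]]]].
    by rewrite def_la eq_r -defA eqxx in ne_la.
  by rewrite def_la eq_r eq_b' defB.
by case: s B_s all_s => //= la s _; apply; apply: mem_head.
Qed.

Lemma growthS Q i j : growth Q i.+1 j.+1 =
  if j.+1 <= i.+1 then [::]
  else local_rule (growth Q i.+1 j) (growth Q i j) (growth Q i j.+1).
Proof. by []. Qed.

(** The square with corners Lambda_{i+1,j}, Lambda_{i,j}, Lambda_{i+1,j+1} and
    Lambda_{i,j+1} is the one of [jdt_wordP], for the word that consists of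
    the letters of [w] at the positions i, .., j (counted from 0). *)
Lemma growth_factor Q (w : seq nat) :
    uniq w -> (forall j, j <= size w -> restricted_shape Q j = sh (take j w)) ->
  forall i j, i <= j -> j <= size w -> growth Q i j = sh (drop i (take j w)).
Proof.
move=> uniq_w growth0; elim=> [|i IHi] j.
  by move=> _ /growth0; rewrite drop0.
elim: j => // j IHj; rewrite ltnS leq_eqVlt growthS.
move=> /predU1P[<- _|lt_ij lt_jw].
  by rewrite leqnn drop_oversize // size_take; case: ifP; lia.
have -> : (j.+1 <= i.+1) = false by lia.
rewrite IHj ?(ltnW lt_jw) // !IHi //; try lia.
have size_j : size (take j w) = j by rewrite size_takel // ltnW.
rewrite (take_nth 0 lt_jw) !drop_rcons ?size_j //; last by lia.
rewrite (@drop_nth _ 0 i) ?size_j // rcons_cons.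
apply: local_rule_jdt; last apply: jdt_wordP.
  by apply/sh_partition/drop_uniq/take_uniq.
rewrite -rcons_cons -drop_nth ?size_j // -drop_rcons ?size_j; last by lia.
by rewrite -(take_nth 0) // drop_uniq // take_uniq.
Qed.

(** * Tableaux of chains of partitions *)

Lemma new_row_incr la r : new_row la (incr_nth la r) = r.
Proof.
rewrite /new_row; set s := iota _ _.
have r_lt : r < size (incr_nth la r) by rewrite size_incr_nth; case: ifP; lia.
have r_s : r < size s by rewrite size_iota.
rewrite (@eq_find _ _ (pred1 r)) => [|q]; last by rewrite nth_incr_nth /=; lia.
have := index_uniq 0 r_s (iota_uniq 0 _).
by rewrite {1}/s nth_iota.
Qed.

Lemma nth_tableau_of_chain c n r :
  nth [::] (tableau_of_chain c n) r =
  [seq k <- iota 1 n | new_row (c k.-1) (c k) == r].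
Proof.
rewrite /tableau_of_chain; elim: n => [|n IHn]; first by rewrite nth_nil.
rewrite -[n.+1]addn1 iotaD foldl_cat filter_cat -IHn /= add1n.
rewrite nth_set_nth /= eq_sym.
by case: eqP => [->|]; rewrite ?cats1 ?cats0.
Qed.

Lemma sumn_incr_nth s i : sumn (incr_nth s i) = (sumn s).+1.
Proof.
elim: s i => [|m s IHs] [|i] //=; last by rewrite IHs addnS.
by elim: i => //= i ->.
Qed.

Lemma sumn_shape_chain c n : sumn (shape (tableau_of_chain c n)) = n.
Proof.
rewrite /tableau_of_chain; elim: n => // n IHn.
rewrite -[n.+1]addn1 iotaD foldl_cat /=; set T := foldl _ _ _ in IHn *.
rewrite -[set_nth _ _ _ _]/(add_entry _ _ _) shape_add_entry.
by rewrite sumn_incr_nth IHn addn1.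
Qed.

Definition is_chain c n :=
  c 0 = [::] /\
  forall k, 0 < k <= n ->
    exists2 r, c k = incr_nth (c k.-1) r & is_partition (c k).

Lemma count_chain c n r j : is_chain c n -> j <= n ->
  count (fun x => x <= j) (nth [::] (tableau_of_chain c n) r) = nth 0 (c j) r.
Proof.
move=> [c0 cS] le_jn; rewrite nth_tableau_of_chain count_filter.
rewrite -(subnKC le_jn) iotaD count_cat.
rewrite [X in _ + X](_ : _ = 0) ?addn0; last first.
  apply/eqP; rewrite -leqn0 leqNgt -has_count.
  by apply/hasPn => x; rewrite mem_iota /=; lia.
rewrite (@eq_in_count _ _ (fun k => new_row (c k.-1) (c k) == r)); last first.
  by move=> k; rewrite mem_iota /=; lia.
elim: j le_jn => [|j IHj] le_jn; first by rewrite c0 nth_nil.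
rewrite -[j.+1]addn1 iotaD count_cat IHj; last exact: ltnW.
have [//|q def_c _] := cS j.+1.
by rewrite addn1 /= add1n /= def_c new_row_incr nth_incr_nth addn0 addnC.
Qed.

Lemma filter_pos_partition s p : is_partition p ->
  (forall r, nth 0 s r = nth 0 p r) -> [seq m <- s | 0 < m] = p.
Proof.
move=> /is_partitionP[_ pos_p] eq_sp.
have le_ps : size p <= size s.
  by rewrite leqNgt pos_p -eq_sp nth_default.
rewrite -(cat_take_drop (size p) s) filter_cat.
have -> : take (size p) s = p.
  apply: (@eq_from_nth _ 0); rewrite size_takel // => i lt_i.
  by rewrite nth_take.
have -> : [seq m <- drop (size p) s | 0 < m] = [::].
  apply/eqP; rewrite -[_ == _]negbK -has_filter.
  apply/(has_nthP 0) => -[i lt_i].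
  by rewrite nth_drop eq_sp -pos_p; lia.
rewrite cats0; apply/all_filterP/(all_nthP 0) => i.
by rewrite pos_p.
Qed.

Lemma restricted_shape_chain c n j : is_chain c n -> j <= n ->
  restricted_shape (tableau_of_chain c n) j = c j.
Proof.
move=> chain_c le_jn; apply: filter_pos_partition.
  case: chain_c => c0 cS; case: j le_jn => [|j] le_jn; first by rewrite c0.
  by case: (cS j.+1).
move=> r; rewrite -(count_chain r chain_c le_jn).
have [lt_r|ge_r] := ltnP r (size (tableau_of_chain c n)).
  by rewrite (nth_map [::]).
by rewrite !nth_default ?size_map.
Qed.

(** * The first row of a tableau *)

(** In an increasing sequence, the entries at most [m] come first. *)
Lemma nth_sorted_le s k m : sorted ltn s -> k < size s ->
  (nth 0 s k <= m) = (k < count (fun x => x <= m) s).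
Proof.
elim: s k => // x s IHs k /= path_s lt_k.
have /allP gt_x := order_path_min ltn_trans path_s.
case: (leqP x m) => [le_xm|lt_mx].
  by case: k lt_k => [|k] //= lt_k; rewrite IHs ?(path_sorted path_s).
have -> : count (fun x => x <= m) s = 0.
  apply/eqP; rewrite -leqn0 leqNgt -has_count; apply/hasPn => y /gt_x /=; lia.
case: k lt_k => [|k] /= lt_k; first by lia.
have := gt_x _ (mem_nth 0 lt_k) => /=; lia.
Qed.

Lemma size_row1_chain c n : is_chain c n ->
  size (nth [::] (tableau_of_chain c n) 0) = nth 0 (c n) 0.
Proof.
move=> chain_c; rewrite -(count_chain 0 chain_c (leqnn n)); apply/esym/eqP.
rewrite -all_count nth_tableau_of_chain; apply/allP => k.
by rewrite mem_filter mem_iota; lia.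
Qed.

Lemma entry_row1_le c n i m :
    is_chain c n -> 0 < i <= nth 0 (c n) 0 -> m <= n ->
  (entry (tableau_of_chain c n) 1 i <= m) = (i <= nth 0 (c m) 0).
Proof.
move=> chain_c i_le le_mn; rewrite /entry [1.-1]/= nth_sorted_le.
- by rewrite count_chain //; lia.
- rewrite nth_tableau_of_chain; apply: sorted_filter; first exact: ltn_trans.
  exact: iota_ltn_sorted.
by rewrite size_row1_chain //; lia.
Qed.

Definition first_row w := nth [::] (insertion_tableau w) 0.

Lemma nth_sh0 w : nth 0 (sh w) 0 = size (first_row w).
Proof. exact: nth_shape. Qed.

Lemma first_row_rcons w x : first_row (rcons w x) =
  set_nth 0 (first_row w) (find (fun y => x < y) (first_row w)) x.
Proof.
rewrite /first_row insertion_tableau_rcons.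
by case: (insertion_tableau w) => //= row T; case: ifP.
Qed.

Lemma subseq_rconsP (u w : seq nat) (x : nat) : subseq u (rcons w x) ->
  subseq u w \/ exists2 u' : seq nat, u = rcons u' x & subseq u' w.
Proof.
case/subseqP=> m; case/lastP: m => [|m b]; rewrite !size_rcons //.
move=> -[size_m] ->.
rewrite mask_rcons //; case: b; rewrite ?cats0 ?cats1 /=; last first.
  by left; apply: mask_subseq.
by right; exists (mask m w); rewrite ?cats1 //; apply: mask_subseq.
Qed.

Lemma sorted_rcons_leq u x : sorted leq u -> (u != [::] -> last 0 u <= x) ->
  sorted leq (rcons u x).
Proof.
case: u => //= y u path_u le_x; rewrite rcons_path path_u.
by rewrite /= le_x.
Qed.

(** Entry [k] of the first row is the smallest last letter of an increasing
    subword of length [k.+1].  Appending [x] only changes the first entry larger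
    than [x]: the subwords that [x] extends are those whose last letter is at
    most [x], hence those of length at most the index of that entry. *)
Lemma schensted_invariant w : let row := first_row w in
  [/\ sorted leq row,
      forall k, k < size row -> exists2 u, subseq u w &
        [/\ sorted leq u, size u = k.+1 & last 0 u = nth 0 row k]
    & forall u, subseq u w -> sorted leq u -> u != [::] ->
        size u <= size row /\ nth 0 row (size u).-1 <= last 0 u].
Proof.
elim/last_ind: w => [|w x]; first by split=> // u; rewrite subseq0 => /eqP ->.
rewrite first_row_rcons; set row := first_row w; set k := find _ row.
move=> /= [sorted_row witness bound].
have le_row i j : i <= j -> j < size row -> nth 0 row i <= nth 0 row j.
  move=> le_ij lt_j; apply: (sorted_leq_nth leq_trans leqnn 0 sorted_row) => //.
  by rewrite inE; lia.
have le_k : k <= size row := find_size _ _.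
have lt_k i : i < k -> nth 0 row i <= x.
  by move/(before_find 0) => /negbT; rewrite -leqNgt.
have gt_k : k < size row -> x < nth 0 row k.
  by rewrite -has_find => /(nth_find 0).
clearbody k row; split.
- apply/(sortedP 0) => i; rewrite size_set_nth => lt_i.
  rewrite !nth_set_nth /=; have [eq_i|ne_i] := eqVneq i k.
    subst i; have -> : (k.+1 == k) = false by lia.
    by have := @le_row k k.+1; lia.
  case: eqVneq => [eq_i|ne_iS]; first by apply: lt_k; rewrite -eq_i.
  by apply: le_row; lia.
- move=> i; rewrite size_set_nth nth_set_nth /=; case: eqVneq => [->|ne_i] lt_i.
    case def_k: k => [|k1].
      by exists [:: x]; rewrite // sub1seq mem_rcons mem_head.
    have [|u sub_u [sorted_u size_u last_u]] := witness k1; first by lia.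
    exists (rcons u x); first by rewrite -!cats1 cat_subseq.
    split; rewrite ?size_rcons ?size_u ?last_rcons //.
    by apply: sorted_rcons_leq => // _; rewrite last_u; apply: lt_k; lia.
  have [|u sub_u u_prop] := witness i; first by lia.
  by exists u => //; apply: subseq_trans sub_u (subseq_rcons _ _).
move=> u /subseq_rconsP[sub_u|[u' -> sub_u']] sorted_u u_neq0.
  have [le_size le_last] := bound u sub_u sorted_u u_neq0.
  rewrite size_set_nth nth_set_nth /=; split; first by lia.
  case: eqVneq => // eq_k; apply: leq_trans le_last; rewrite eq_k.
  have u_gt0 : 0 < size u by case: (u) u_neq0.
  by apply/ltnW/gt_k; rewrite -eq_k; lia.
rewrite size_rcons last_rcons size_set_nth nth_set_nth /=.
have le_uk : size u' <= k.
  case: (eqVneq u' [::]) => [->//|u'_neq0].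
  have sorted_u' : sorted leq u'.
    by apply: (subseq_sorted leq_trans) sorted_u; apply: subseq_rcons.
  have [le_size le_last] := bound u' sub_u' sorted_u' u'_neq0.
  have last_x : last 0 u' <= x.
    move: sorted_u; case: (u') u'_neq0 => //= y s _.
    by rewrite rcons_path => /andP[].
  have u'_gt0 : 0 < size u' by case: (u') u'_neq0.
  rewrite leqNgt; apply/negP => lt_ku.
  have := gt_k (leq_trans lt_ku le_size).
  by have := @le_row k (size u').-1; lia.
by split; [lia | case: eqVneq => // ne_k; apply: lt_k; lia].
Qed.

Lemma size_increasing_le w u :
  subseq u w -> sorted leq u -> size u <= nth 0 (sh w) 0.
Proof.
move=> sub_u sorted_u; rewrite nth_sh0; have [-> //|u_neq0] := eqVneq u [::].
by have [_ _ /(_ u sub_u sorted_u u_neq0)[]] := schensted_invariant w.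
Qed.

Lemma ex_increasing w k : k <= nth 0 (sh w) 0 ->
  exists2 u, subseq u w & sorted leq u /\ size u = k.
Proof.
rewrite nth_sh0; case: k => [|k] lt_k; first by exists [::]; rewrite ?sub0seq.
have [_ /(_ k lt_k)[u sub_u [sorted_u size_u _]] _] := schensted_invariant w.
by exists u.
Qed.

(** * Words with one descent *)

Lemma des_cons2 x y s : des [:: x, y & s] = (y < x) + des (y :: s).
Proof.
rewrite /des /=; congr (_ + _).
by rewrite -[1]/(1 + 0) iotaDl count_map; apply: eq_count => i.
Qed.

Lemma des_eq0 s : (des s == 0) = sorted leq s.
Proof.
elim: s => // x [|y s] //= IHs; rewrite des_cons2 /= -IHs.
by case: leqP.
Qed.

(** The only possible descent is at the junction. *)
Lemma des_cat u v : sorted leq u -> sorted leq v -> des (u ++ v) <= 1.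
Proof.
rewrite -!des_eq0 => + /eqP des_v.
elim: u => [|x [|y u] IHu] /=; first by rewrite des_v.
  case: v des_v IHu => //= y v des_v _ _.
  by rewrite des_cons2 des_v; case: leqP.
by rewrite !des_cons2; case: leqP => // _; apply: IHu.
Qed.

Lemma des_split s : des s = 1 -> exists u v,
  [/\ s = u ++ v, sorted leq u, sorted leq v, u != [::] & v != [::]].
Proof.
elim: s => // x [|y s] IHs //; rewrite des_cons2.
case: leqP => /= [le_xy|lt_yx].
  case/IHs => -[|z u] [v [//= [<- eq_s] sorted_u sorted_v _ v_neq0]].
  by exists (x :: y :: u), v; rewrite eq_s /= le_xy.
case=> /eqP; rewrite des_eq0 => sorted_s.
by exists [:: x], (y :: s).
Qed.

Lemma subseq_cat_split (T : eqType) (u v w : seq T) : subseq (u ++ v) w ->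
  exists2 m, m <= size w & subseq u (take m w) /\ subseq v (drop m w).
Proof.
elim: w u => [|x w IHw] u.
  by rewrite subseq0; case: u => // /eqP /= ->; exists 0.
case: u => [|y u] /=; first by exists 0.
have [->|ne_yx] := eqVneq y x.
  case/IHw=> m le_m [sub_u sub_v].
  by exists m.+1 => //=; rewrite eqxx.
case/(IHw (y :: u)) => m le_m [sub_u sub_v].
exists m.+1 => //=; split=> //.
by rewrite (negPf ne_yx).
Qed.

(** * Subwords of a permutation *)

Lemma size_subword n (pi : 'S_n) (I : {set 'I_n}) : size (subword pi I) = #|I|.
Proof. by rewrite size_map cardE. Qed.

Lemma size_word n (pi : 'S_n) : size (subword pi setT) = n.
Proof. by rewrite size_subword cardsT card_ord. Qed.

Lemma uniq_word n (pi : 'S_n) : uniq (subword pi setT).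
Proof.
rewrite map_inj_uniq ?enum_uniq // => i j [/val_inj].
exact: perm_inj.
Qed.

Lemma enum_sub n (I : {set 'I_n}) :
  enum I = [seq i <- enum [set: 'I_n] | i \in I].
Proof. by rewrite enum_setT. Qed.

Lemma subword_subseq n (pi : 'S_n) (I : {set 'I_n}) :
  subseq (subword pi I) (subword pi setT).
Proof. by rewrite /subword enum_sub; apply/map_subseq/filter_subseq. Qed.

Lemma ex_subword n (pi : 'S_n) u :
  subseq u (subword pi setT) -> exists I : {set 'I_n}, subword pi I = u.
Proof.
move/(subseq_uniqP (uniq_word pi)) => ->.
exists [set i | (pi i).+1 \in u].
rewrite /subword enum_sub filter_map; congr map.
by apply: eq_filter => i; rewrite inE.
Qed.

Lemma sorted_word n (pi : 'S_n) : sorted leq (subword pi setT) -> pi = 1%g.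
Proof.
move=> sorted_W; have sorted_ltW : sorted ltn (subword pi setT).
  by rewrite ltn_sorted_uniq_leq uniq_word.
have eq_W : (subword pi setT) = iota 1 n.
  apply: (irr_sorted_eq ltn_trans ltnn) => //; first exact: iota_ltn_sorted.
  move=> v; rewrite mem_iota; apply/mapP/idP => [[i _ ->]|v_n].
    by have := ltn_ord (pi i); lia.
  have lt_v : v.-1 < n by lia.
  exists (pi^-1 (Ordinal lt_v))%g; first by rewrite mem_enum inE.
  by rewrite permKV /=; lia.
apply/permP => i; rewrite perm1; apply: val_inj => /=.
have := congr1 (fun s => nth 0 s i) eq_W.
rewrite nth_iota // (nth_map i) enum_setT -enumT ?size_enum_ord //.
by rewrite nth_ord_enum; lia.
Qed.

(** A new letter [z] splits the increasing subword of [J] into [u] and [v].  If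
    [z] is smaller than the last letter of [u], it is smaller than the letters
    of [v], so both [u] and [z :: v] increase; otherwise both [rcons u z] and
    [v] do. *)
Lemma extend_increasing n (pi : 'S_n) (J : {set 'I_n}) : pi <> 1%g ->
  sorted leq (subword pi J) ->
  exists2 J' : {set 'I_n}, #|J| < #|J'| & des (subword pi J') <= 1.
Proof.
move=> pi_neq1 sorted_J.
have /subsetPn[x _ x_J] : ~~ ([set: 'I_n] \subset J).
  apply/negP; rewrite subTset => /eqP eq_J; apply: pi_neq1.
  by rewrite eq_J in sorted_J; apply: sorted_word.
exists (x |: J); first by rewrite cardsU1 x_J.
have : x \in enum [set: 'I_n] by rewrite mem_enum inE.
have := enum_uniq [set: 'I_n].
rewrite /subword (enum_sub (x |: J)).
move: sorted_J; rewrite /subword (enum_sub J).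
move=> + + x_enum; case/splitPr: x_enum => p q.
rewrite -cat1s uniq_catCA /= mem_cat negb_or => + /andP[/andP[x_p x_q] _].
have in_J s : x \notin s ->
    [seq i <- s | i \in x |: J] = [seq i <- s | i \in J].
  move=> x_s; apply: eq_in_filter => i i_s; rewrite !inE.
  by case: eqP => // eq_i; rewrite -eq_i i_s in x_s.
rewrite !filter_cat /= (negPf x_J) setU11 !in_J // !map_cat /=.
set u := map _ _; set v := map _ _; set z := (pi x).+1 => sorted_uv.
have [sorted_u sorted_v] : sorted leq u /\ sorted leq v.
  split; apply: (subseq_sorted leq_trans) sorted_uv.
    exact: prefix_subseq.
  exact: suffix_subseq.
have [lt_zu|le_uz] := ltnP z (last 0 u).
  apply: des_cat => //; move: sorted_uv; rewrite -cat1s /= in sorted_v *.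
  case: (lastP u) lt_zu => //= u1 t; rewrite last_rcons => lt_zt.
  rewrite cat_rcons; case: (v) sorted_v => //= b v1 sorted_v.
  move/cat_sorted2 => [_] /= /andP[le_tb _].
  by rewrite sorted_v; lia.
rewrite -cat_rcons; apply: des_cat => //.
by apply: sorted_rcons_leq.
Qed.

(** If [u] has no descent, enlarge by one element a largest set of positions
    whose subword has no descent: maximality forces exactly one descent. *)
Lemma ls1_ge n (pi : 'S_n) u : pi <> 1%g ->
  subseq u (subword pi setT) -> des u <= 1 -> size u <= ls1 pi.
Proof.
have max_card (I : {set 'I_n}) : des (subword pi I) == 1 -> #|I| <= ls1 pi.
  exact: (@leq_bigmax_cond _ (fun I => des (subword pi I) == 1)).
move=> pi_neq1 /ex_subword[I <-]; rewrite size_subword leq_eqVlt.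
case/orP=> [/max_card //|].
rewrite ltnS leqn0 => des_I.
case: (@arg_maxnP _ I (fun J => des (subword pi J) == 0) (fun J => #|J|) des_I).
move=> J des_J max_J.
have [J' lt_J des_J'] : exists2 J' : {set 'I_n},
    #|J| < #|J'| & des (subword pi J') <= 1.
  by apply: extend_increasing => //; rewrite -des_eq0.
apply: leq_trans (max_J I des_I) (leq_trans (ltnW lt_J) _).
apply: max_card.
move: des_J'; rewrite leq_eqVlt ltnS leqn0 => /orP[//|/max_J].
by rewrite /geq /= leqNgt lt_J.
Qed.

Theorem proposition3p8 (n : nat) (pi : 'S_n) (pi_neq1 : pi <> 1%g) :
  let Q := Qtab pi in
  ls1 pi = \max_(1 <= i < (size (nth [::] Q 0)).+1)
             \max_(1 <= j < (size (nth [::] Q 0)).+1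
                   | entry Q 1 i + entry (evac Q) 1 j <= n) (i + j).
Proof.
move=> Q; set W := subword pi setT.
have uniq_W : uniq W := uniq_word pi; have size_W : size W = n := size_word pi.
have chain_Q : is_chain (fun k => sh (take k W)) n.
  split=> [|[|k] // /andP[_ lt_kn]]; first by rewrite take0.
  exists (new_box_row (nth 0 W k) (insertion_tableau (take k W))).
    by rewrite (take_nth 0) ?size_W // sh_rcons.
  by rewrite sh_partition // take_uniq.
have growthE i j : i <= j -> j <= n -> growth Q i j = sh (drop i (take j W)).
  rewrite -size_W; apply: growth_factor => // k; rewrite size_W => le_kn.
  rewrite -(restricted_shape_chain chain_Q le_kn).
  by rewrite /Q /Qtab /recording_tableau size_W.
have evacE : evac Q = tableau_of_chain (fun i => growth Q (n - i) n) n.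
  by rewrite /evac {2 3}/Q /Qtab /recording_tableau sumn_shape_chain size_W.
have growth_suffix k : k <= n -> growth Q (n - k) n = sh (drop (n - k) W).
  by move=> le_kn; rewrite growthE ?leq_subr // take_oversize ?size_W.
have chain_evac : is_chain (fun i => growth Q (n - i) n) n.
  split=> [|[|k] // /andP[_ lt_kn]].
    by rewrite growth_suffix // subn0 drop_oversize ?size_W.
  rewrite /= !growth_suffix ?(ltnW lt_kn) //.
  have lt_nk : n - k.+1 < size W by rewrite size_W; lia.
  have part : is_partition (sh (drop (n - k.+1) W)).
    by rewrite sh_partition // drop_uniq.
  have def_drop : drop (n - k.+1) W = nth 0 W (n - k.+1) :: drop (n - k) W.
    by rewrite (drop_nth 0) // -subSn // subSS.
  have [|a [eq_sh _]] := @adds_cons (nth 0 W (n - k.+1)) (drop (n - k) W).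
    by rewrite -def_drop drop_uniq.
  by exists a; rewrite // def_drop.
have size_Q : size (nth [::] Q 0) = nth 0 (sh W) 0.
  rewrite /Q /Qtab /recording_tableau size_W size_row1_chain //.
  by rewrite take_oversize ?size_W.
rewrite size_Q.
have entry_Q i m : 0 < i <= nth 0 (sh W) 0 -> m <= n ->
    (entry Q 1 i <= m) = (i <= nth 0 (sh (take m W)) 0).
  move=> i_le le_mn; rewrite /Q /Qtab /recording_tableau size_W.
  by rewrite (entry_row1_le chain_Q) // take_oversize ?size_W.
have entry_evac j m : 0 < j <= nth 0 (sh W) 0 -> m <= n ->
    (entry (evac Q) 1 j <= m) = (j <= nth 0 (sh (drop (n - m) W)) 0).
  move=> j_le le_mn; rewrite evacE (entry_row1_le chain_evac) ?growth_suffix //.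
  by rewrite subnn drop0.
apply/eqP; rewrite eqn_leq; apply/andP; split.
  apply/bigmax_leqP => I /eqP /des_split[u [v [eq_I su sv u_neq0 v_neq0]]].
  have sub_I : subseq (u ++ v) W by rewrite -eq_I subword_subseq.
  have [m le_m [sub_u sub_v]] := subseq_cat_split sub_I.
  rewrite -(size_subword pi) eq_I size_cat.
  have le_u := size_increasing_le sub_u su.
  have le_v := size_increasing_le sub_v sv.
  have u_le : 0 < size u <= nth 0 (sh W) 0.
    rewrite size_increasing_le // ?andbT; first by case: (u) u_neq0.
    exact: subseq_trans (prefix_subseq _ _) sub_I.
  have v_le : 0 < size v <= nth 0 (sh W) 0.
    rewrite size_increasing_le // ?andbT; first by case: (v) v_neq0.
    exact: subseq_trans (suffix_subseq _ _) sub_I.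
  rewrite size_W in le_m.
  apply: leq_trans (leq_bigmax_seq (size u) _ _) => //; last first.
    by rewrite mem_index_iota.
  apply: (@leq_bigmax_seq _ _ _ _ (size v)); first by rewrite mem_index_iota.
  have := entry_Q _ _ u_le le_m; rewrite le_u.
  have := entry_evac _ _ v_le (leq_subr m n); rewrite subKn // le_v.
  lia.
apply/bigmax_leqP_seq => i; rewrite mem_index_iota ltnS => i_le _.
apply/bigmax_leqP_seq => j; rewrite mem_index_iota ltnS => j_le le_n.
set m := entry Q 1 i in le_n.
have le_mn : m <= n by lia.
have [|u sub_u [sorted_u size_u]] := @ex_increasing (take m W) i.
  by rewrite -entry_Q.
have [|v sub_v [sorted_v size_v]] := @ex_increasing (drop m W) j.
  rewrite -[m](subKn le_mn) -entry_evac ?leq_subr //; lia.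
rewrite -size_u -size_v -size_cat; apply: ls1_ge => //; last exact: des_cat.
by rewrite -(cat_take_drop m (subword pi setT)); apply: cat_subseq.
Qed.
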